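(* Let $2\le k\le n$ be integers and put $N:=n\binom{n}{k}$. Then the spectral decompositions of the $k$-vertex sub-hypergraphs of a directed weighted $k$-uniform hypergraph on $n$ vertices without degenerate hyperedges determine the spectral decomposition of a larger $k$-uniform hypergraph on $N$ vertices which contains it as a sub-hypergraph. That is: there is an assignment $\Phi=\Phi_{n,k}$ such that, for every directed weighted $k$-uniform hypergraph $H$ on the vertex set $\{0,\dots,n-1\}$ having no degenerate hyperedges, with adjacency hypermatrix $\mathbf{A}$, and for every family $\mathcal{D}=(\mathcal{D}_S)_{S}$, indexed by the $k$-element subsets $S\subseteq\{0,\dots,n-1\}$, in which $\mathcal{D}_S$ is a spectral decomposition of the adjacency hypermatrix $\mathbf{A}|_S$ of the sub-hypergraph of $H$ induced on $S$, the value $\Phi(\mathcal{D})$ is a spectral decomposition of a cubic hypermatrix $\mathbf{B}$ of order $k$ and side length $N$ (the adjacency hypermatrix of a directed weighted $k$-uniform hypergraph on $N$ vertices) satisfying $$b_{i_0,\dots,i_{k-1}}=a_{i_0,\dots,i_{k-1}}\qquad\text{for all }0\le i_0,\dots,i_{k-1}<n .$$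
   Context: A cubic hypermatrix of order $k$ and side length $p$ is a family $\mathbf{A}=(a_{i_0,\dots,i_{k-1}})_{0\le i_0,\dots,i_{k-1}<p}$ of complex numbers. Hypergraphs. A directed weighted $k$-uniform hypergraph on the vertex set $\{0,\dots,p-1\}$ is identified with its adjacency hypermatrix, the cubic hypermatrix of order $k$ and side length $p$ whose $(i_0,\dots,i_{k-1})$ entry is the (complex) weight of the ordered hyperedge $(i_0,\dots,i_{k-1})$, and is $0$ if this is not a hyperedge. It has no degenerate hyperedges if $a_{i_0,\dots,i_{k-1}}=0$ whenever $i_0,\dots,i_{k-1}$ are not pairwise distinct. The larger hypergraph on $N$ vertices is not required to be free of degenerate hyperedges. For a subset $S=\{s_0<\dots<s_{k-1}\}$ of the vertices, $\mathbf{A}|_S$ is the cubic hypermatrix of order $k$ and side length $k$ with entries $(\mathbf{A}|_S)_{i_0,\dots,i_{k-1}}=a_{s_{i_0},\dots,s_{i_{k-1}}}$. Spectral decompositions. Write $\delta_{i_0,\dots,i_{k-1}}=1$ if $i_0=\dots=i_{k-1}$, and $0$ otherwise. Case $k=2$. A spectral decomposition of a $p\times p$ matrix $\mathbf{A}$ consists of $p\times p$ complex matrices $\mathbf{U},\mathbf{V}$ and vectors $\boldsymbol{\mu},\boldsymbol{\nu}\in\mathbb{C}^p$ with $$\mathbf{A}=(\mathbf{U}\,\mathrm{diag}(\boldsymbol{\mu}))(\mathbf{V}\,\mathrm{diag}(\boldsymbol{\nu}))^{\dagger},\qquad \mathbf{U}\mathbf{V}^{\dagger}=\mathbf{I}_p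 ,$$ where $\dagger$ is the conjugate transpose. Case $k\ge 3$. Indices of $i$ are read modulo $k$. A spectral decomposition of a cubic hypermatrix $\mathbf{A}$ of order $k$ and side length $p$ consists of, for each $t\in\{0,\dots,k-1\}$, vectors $\mathbf{q}^{(t)}_{j_1,\dots,j_{k-1}}\in\mathbb{C}^p$ (for all $0\le j_1,\dots,j_{k-1}<p$) and scaling vectors $\boldsymbol{\lambda}^{(t)}_{j}\in\mathbb{C}^p$ (for $0\le j<p$), such that for all $0\le i_0,\dots,i_{k-1}<p$ $$a_{i_0,\dots,i_{k-1}}=\sum_{0\le r<p}\ \prod_{t=0}^{k-1}\Big[\Big(\prod_{0\le s<k,\ s\not\equiv t+1 \,(\mathrm{mod}\ k)}\big(\boldsymbol{\lambda}^{(t)}_{i_s}\big)_r\Big)\,\big(\mathbf{q}^{(t)}_{i_t,\,i_{t+2},\,i_{t+3},\dots,\,i_{t+k-1}}\big)_r\Big],$$ $$\sum_{0\le r<p}\ \prod_{t=0}^{k-1}\big(\mathbf{q}^{(t)}_{i_t,\,i_{t+2},\,i_{t+3},\dots,\,i_{t+k-1}}\big)_r=\delta_{i_0,\dots,i_{k-1}} .$$ For example, for $k=3$, with $\boldsymbol{\alpha}=\boldsymbol{\lambda}^{(0)}$, $\boldsymbol{\beta}=\boldsymbol{\lambda}^{(1)}$, $\boldsymbol{\gamma}=\boldsymbol{\lambda}^{(2)}$ and $\mathbf{q},\mathbf{u},\mathbf{v}$ for $\mathbf{q}^{(0)},\mathbf{q}^{(1)},\mathbf{q}^{(2)}$, this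 says that $a_{i,j,k}$ is the sum of the entries of the entrywise product $(\boldsymbol{\alpha}_i\circ\mathbf{q}_{ik}\circ\boldsymbol{\alpha}_k)\circ(\boldsymbol{\beta}_j\circ\mathbf{u}_{ji}\circ\boldsymbol{\beta}_i)\circ(\boldsymbol{\gamma}_k\circ\mathbf{v}_{kj}\circ\boldsymbol{\gamma}_j)$, and that $\delta_{i,j,k}$ is the sum of the entries of $\mathbf{q}_{ik}\circ\mathbf{u}_{ji}\circ\mathbf{v}_{kj}$. *)

(* Defs.v *)
(* The complex numbers are R[i], for R : realType. *)
From HB Require Import structures.
From mathcomp Require Import all_boot all_order all_algebra spectral.
From mathcomp Require Export complex reals.

Set Implicit Arguments.
Unset Strict Implicit.
Unset Printing Implicit Defensive.

Import GRing.Theory Num.Theory.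
Local Open Scope ring_scope.
Local Open Scope sesquilinear_scope.

Definition hypermatrix (C : Type) (k p : nat) : Type :=
  {ffun 'I_k -> 'I_p} -> C.

Definition no_degenerate_hyperedges (C : nmodType) (k p : nat)
    (A : hypermatrix C k p) : Prop :=
  forall i : {ffun 'I_k -> 'I_p}, ~ injective i -> A i = 0.

Definition ksubset (n k : nat) : Type := {S : {set 'I_n} | #|S| == k}.

(* The s-th smallest element of S; see [ksubset_elt_lt]. *)
Definition ksubset_elt (n k : nat) (S : ksubset n k) (s : 'I_k) : 'I_n :=
  enum_val (cast_ord (esym (eqP (valP S))) s).

Lemma ksubset_elt_in (n k : nat) (S : ksubset n k) (s : 'I_k) :
  ksubset_elt S s \in val S.
Proof. exact: enum_valP. Qed.

Lemma ksubset_elt_lt (n k : nat) (S : ksubset n k) (s s' : 'I_k) :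
  (s < s')%N -> (ksubset_elt S s < ksubset_elt S s')%N.
Proof.
move=> lt_ss'; have sz: size (enum (val S)) = k by rewrite -cardE (eqP (valP S)).
have srt: sorted ltn (map val (enum (val S))).
  apply: (@subseq_sorted _ _ ltn_trans _ (iota 0 n)); last exact: iota_ltn_sorted.
  rewrite -val_enum_ord; apply: map_subseq.
  by rewrite {1}/enum_mem -enumT; exact: filter_subseq.
have nthE (t : 'I_k) :
    val (ksubset_elt S t) = nth 0%N (map val (enum (val S))) t.
  rewrite (nth_map (ksubset_elt S t)) ?sz //.
  by rewrite {1}/ksubset_elt (enum_val_nth (ksubset_elt S t)).
rewrite !nthE; apply: (sorted_ltn_nth ltn_trans 0%N srt) => //;
  by rewrite inE size_map sz.
Qed.

Definition induced (C : Type) (n k : nat) (A : hypermatrix C k n)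
    (S : ksubset n k) : hypermatrix C k k :=
  fun i => A [ffun s => ksubset_elt S (i s)].

Definition matrix_of_hypermatrix (C : Type) (p : nat) (A : hypermatrix C 2 p) :
    'M[C]_p :=
  \matrix_(i, j) A [ffun s : 'I_2 => if s == ord0 then i else j].

Record spectral_data2 (C : Type) (p : nat) : Type := SpectralData2 {
  sd2_U : 'M[C]_p;
  sd2_V : 'M[C]_p;
  sd2_mu : 'rV[C]_p;
  sd2_nu : 'rV[C]_p
}.

Definition is_spectral_decomposition2 (C : numClosedFieldType) (p : nat)
    (A : hypermatrix C 2 p) (D : spectral_data2 C p) : Prop :=
  matrix_of_hypermatrix A =
    (sd2_U D *m diag_mx (sd2_mu D)) *m (sd2_V D *m diag_mx (sd2_nu D))^t*
  /\ sd2_U D *m (sd2_V D)^t* = 1%:M.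

Record spectral_data3 (C : Type) (k p : nat) : Type := SpectralData3 {
  sd3_q : 'I_k -> {ffun 'I_k.-1 -> 'I_p} -> 'rV[C]_p;
  sd3_lam : 'I_k -> 'I_p -> 'rV[C]_p
}.

(* (i_t, i_(t+2), i_(t+3), ..., i_(t+k-1)), subscripts modulo k: [ordS] is the
   cyclic successor, and [bump 1] sends 0, 1, 2, ... to 0, 2, 3, ... *)
Definition skip_next (k p : nat) (i : {ffun 'I_k -> 'I_p}) (t : 'I_k) :
    {ffun 'I_k.-1 -> 'I_p} :=
  [ffun m : 'I_k.-1 => i (iter (bump 1 m) (@ordS k) t)].

Definition is_spectral_decomposition3 (C : numClosedFieldType) (k p : nat)
    (A : hypermatrix C k p) (D : spectral_data3 C k p) : Prop :=
  (forall i : {ffun 'I_k -> 'I_p},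
     A i = \sum_(r < p) \prod_(t < k)
             ((\prod_(s < k | s != ordS t) sd3_lam D t (i s) ord0 r)
              * sd3_q D t (skip_next i t) ord0 r))
  /\
  (forall i : {ffun 'I_k -> 'I_p},
     \sum_(r < p) \prod_(t < k) sd3_q D t (skip_next i t) ord0 r
     = ([forall s, forall s', i s == i s'] : nat)%:R).

(* Only k >= 2 is meaningful; orders 0 and 1 fall in the default branch. *)
Definition spectral_data (C : Type) (k p : nat) : Type :=
  match k with
  | 2 => spectral_data2 C p
  | k' => spectral_data3 C k' p
  end.

Definition is_spectral_decomposition (C : numClosedFieldType) (k p : nat) :
    hypermatrix C k p -> spectral_data C k p -> Prop :=
  match k return hypermatrix C k p -> spectral_data C k p -> Prop with
  | 2 => @is_spectral_decomposition2 C p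
  | k' => @is_spectral_decomposition3 C k' p
  end.

Lemma leq_mul_bin (n k : nat) : (k <= n)%N -> (n <= n * 'C(n, k))%N.
Proof. by move=> le_kn; rewrite leq_pmulr // bin_gt0. Qed.

(* Main.v *)
(** The hypermatrix [A] can be read off from the family [D]: every
    nondegenerate hyperedge lies in exactly one k-element subset, and a
    decomposition determines the hypermatrix it decomposes.  If [k = n], then
    [N = n] and the only member of [D] is the required decomposition.
    If [k < n], then [N > 2 n], and any [A] extends to a decomposable
    hypermatrix of side [N].  For [k = 2], [A] is a corner of the idempotent
    [[A, 1-A], [A, 1-A]].  For [k >= 3], a product of functions, each of which
    ignores one coordinate, can be the slice [i_1 = r] of [A], its opposite, or
    the hypermatrix delta; the [n] slices, their opposites and delta add up to
    delta, and weights 0 and 1 retain only the slices, whose sum is [A]. *)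

Require Import Defs.
From mathcomp Require Import all_boot all_order all_algebra.
From mathcomp Require Import complex reals.
From mathcomp Require Import spectral boolp zify.

Set Implicit Arguments.
Unset Strict Implicit.
Unset Printing Implicit Defensive.

Import GRing.Theory Num.Theory.
Local Open Scope ring_scope.
Local Open Scope sesquilinear_scope.

(** * Lower bounds for $N$ *)

Lemma leq_bin_pos (n k : nat) : (0 < k < n)%N -> (n <= 'C(n, k))%N.
Proof.
elim: n k => [|n IHn] [|k] //=; rewrite ltnS binS => ltkn.
case: k ltkn => [|k] ltkn; first by rewrite bin1 bin0 addn1.
(* In Pascal's rule one term is at least [n] and the other positive. The first is the large one,
   except when it is 'C(n, n) = 1. *)
have [eq_n|ne_n] := eqVneq k.+2 n.
  by rewrite eq_n binn add1n ltnS IHn //= -eq_n.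
have h1 : (n <= 'C(n, k.+2))%N by apply: IHn; rewrite /= ltn_neqAle ne_n.
have h2 : (0 < 'C(n, k.+1))%N by rewrite bin_gt0 ltnW.
by rewrite -addn1 leq_add.
Qed.

Lemma double_lt_mul_bin (n k : nat) :
  (1 < k)%N -> (k < n)%N -> (n + n < n * 'C(n, k))%N.
Proof.
move=> lt1k ltkn.
have le3C : (3 <= 'C(n, k))%N.
  apply: leq_trans (leq_bin_pos _); last by rewrite ltkn (ltnW lt1k).
  exact: leq_ltn_trans lt1k ltkn.
have : (n * 3 <= n * 'C(n, k))%N by rewrite leq_mul2l le3C orbT.
by lia.
Qed.

(** * The family of decompositions determines the hypergraph *)

Lemma matrix_of_hypermatrix_inj (C : Type) (p : nat) (A B : hypermatrix C 2 p) :
  matrix_of_hypermatrix A = matrix_of_hypermatrix B -> A =1 B.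
Proof.
move=> eqAB i; have := congr1 (fun M : 'M_p => M (i ord0) (i ord_max)) eqAB.
have -> : i = [ffun s : 'I_2 => if s == ord0 then i ord0 else i ord_max].
  apply/ffunP=> s; rewrite ffunE; case: eqVneq => [-> //|s_neq0].
  by congr (i _); apply: val_inj; case: s s_neq0 => [[|[|m]]].
by rewrite !mxE !ffunE /=.
Qed.

(** Supplies the value of [Phi] at families that decompose no hypergraph. *)
Lemma spectral_data_inhabited (C : nmodType) (k p : nat) :
  inhabited (spectral_data C k p).
Proof.
have d3 j : spectral_data3 C j p by split=> *; exact: 0.
by case: k => [|[|[|k]]]; apply: inhabits => /=; try exact: d3; split; exact: 0.
Qed.

Lemma spectral_decomposition_inj (C : numClosedFieldType) (k p : nat)
    (A B : hypermatrix C k p) (D : spectral_data C k p) :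
  is_spectral_decomposition A D -> is_spectral_decomposition B D -> A =1 B.
Proof.
case: k A B D => [|[|[|k]]] A B D /= [hA _] [hB _];
  try by move=> i; rewrite hA hB.
by apply: matrix_of_hypermatrix_inj; rewrite hA hB.
Qed.

Lemma induced_inj (C : nmodType) (n k : nat) (A B : hypermatrix C k n) :
  no_degenerate_hyperedges A -> no_degenerate_hyperedges B ->
  (forall S : ksubset n k, induced A S =1 induced B S) -> A =1 B.
Proof.
move=> ndA ndB eqAB i.
have [inj_i|ninj_i] := pselect (injective i); last by rewrite ndA ?ndB.
have cardS : #|[set i s | s : 'I_k]| == k.
  by rewrite card_imset // card_ord.
pose S : ksubset n k := exist (fun S : {set 'I_n} => #|S| == k) _ cardS.
have inS s : i s \in val S by apply: imset_f.
(* The ranks in [S] of the entries of [i]: the entry of [induced A S] at [j] is [A i]. *)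
pose j : {ffun 'I_k -> 'I_k} :=
  [ffun s => cast_ord (eqP cardS) (enum_rank_in (inS s) (i s))].
have := eqAB S j; rewrite /induced.
suff -> : [ffun s => ksubset_elt S (j s)] = i by [].
apply/ffunP=> s; rewrite !ffunE /ksubset_elt.
set r := cast_ord _ _; have -> : r = enum_rank_in (inS s) (i s) by apply: val_inj.
exact: enum_rankK_in.
Qed.

(** * The case $k = n$ *)

Definition ksubsetT (k : nat) : ksubset k k :=
  exist (fun S : {set 'I_k} => #|S| == k) [set: 'I_k]
    (introT eqP (etrans (cardsT 'I_k) (card_ord k))).

Lemma ksubset_eltT (k : nat) (s : 'I_k) : ksubset_elt (ksubsetT k) s = s.
Proof.
rewrite /ksubset_elt (enum_val_nth s) /=.
rewrite (eq_enum (in_setT (T := 'I_k))).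
exact: nth_ord_enum.
Qed.

Lemma inducedT (C : Type) (k : nat) (A : hypermatrix C k k) :
  induced A (ksubsetT k) =1 A.
Proof.
move=> i; rewrite /induced; congr (A _).
by apply/ffunP=> s; rewrite ffunE ksubset_eltT.
Qed.

Definition decomposable_extension (C : numClosedFieldType) (k n p : nat)
    (hnp : (n <= p)%N) (A : hypermatrix C k n) (d : spectral_data C k p) : Prop :=
  exists B : hypermatrix C k p, is_spectral_decomposition B d /\
    forall i : {ffun 'I_k -> 'I_n}, B [ffun s => widen_ord hnp (i s)] = A i.

(** The equation is a hypothesis because [n * 'C(n, n)] equals [n] without reducing to it. *)
Lemma decomposable_extension_eq (C : numClosedFieldType) (k n p : nat)
    (hnp : (n <= p)%N) (A : hypermatrix C k n) (d : spectral_data C k n) :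
  p = n -> is_spectral_decomposition A d ->
  exists d' : spectral_data C k p, decomposable_extension hnp A d'.
Proof.
move=> eq_pn; subst p => hA; exists d; exists A; split=> // i; congr (A _).
by apply/ffunP=> s; rewrite ffunE; apply: val_inj.
Qed.

(** * Extension in order 2 *)

Lemma decomposable_extension2 (C : numClosedFieldType) (n p : nat)
    (hnp : (n <= p)%N) (A : hypermatrix C 2 n) : (n + n <= p)%N ->
  exists d : spectral_data C 2 p, decomposable_extension hnp A d.
Proof.
move=> le2np; have [m def_p] : exists m, p = (n + n + m)%N.
  by exists (p - (n + n))%N; rewrite subnKC.
subst p.
pose M := matrix_of_hypermatrix A.
(* The columns (1, 1) of [U] span the image of the idempotent and the columns (1 - M, -M) its
   kernel; [W] is the inverse of [U], and [mu] holds the eigenvalues. The block of size [m] is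
   padding. *)
pose U : 'M[C]_(n + n + m) := block_mx (block_mx 1%:M (1%:M - M) 1%:M (- M)) 0 0 1%:M.
pose W : 'M[C]_(n + n + m) := block_mx (block_mx M (1%:M - M) 1%:M (- 1%:M)) 0 0 1%:M.
pose mu : 'rV[C]_(n + n + m) := row_mx (row_mx (const_mx 1) 0) 0.
have UW : U *m W = 1%:M.
  rewrite /U /W !mulmx_block !(mulmx0, mul0mx, mul1mx, mulmx1, addr0, add0r).
  rewrite !(mulmxN, mulmx1) opprK subrr subrK addrC subrK addrN.
  by rewrite -!scalar_mx_block.
have UmuW : ulsubmx (ulsubmx (U *m diag_mx mu *m W)) = M.
  rewrite /U /W /mu !diag_mx_row diag_const_mx !raddf0.
  rewrite !mulmx_block !(mulmx0, mul0mx, mul1mx, mulmx1, addr0, add0r).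
  by rewrite block_mxKul mulmx_block block_mxKul mul1mx mul0mx addr0.
have adjK (X : 'M[C]_(n + n + m)) : (X^t*)^t* = X.
  by apply/matrixP=> i j; rewrite !mxE conjCK.
pose B : hypermatrix C 2 (n + n + m) :=
  fun i => (U *m diag_mx mu *m W) (i ord0) (i ord_max).
exists (SpectralData2 U (W^t*) mu (const_mx 1)); exists B; split.
  split=> /=; last by rewrite adjK.
  rewrite diag_const_mx mulmx1 adjK.
  by apply/matrixP=> i j; rewrite mxE /B !ffunE.
move=> i; rewrite /B !ffunE.
have wE j : widen_ord hnp j = lshift m (lshift n j) by apply: val_inj.
have -> : A i = M (i ord0) (i ord_max).
  rewrite mxE; congr (A _); apply/ffunP=> s; rewrite ffunE.
  case: eqVneq => [-> //|s_neq0].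
  by congr (i _); apply: val_inj; case: s s_neq0 => [[|[|m']]].
by rewrite -UmuW !wE [RHS]mxE [RHS]mxE [RHS]mxE [RHS]mxE.
Qed.

(** * Extension in order at least 3 *)

Lemma val_iter_ordS (k j : nat) (s : 'I_k) :
  iter j (@ordS k) s = ((s + j) %% k)%N :> nat.
Proof.
elim: j => [|j IHj]; first by rewrite addn0 modn_small.
by rewrite iterS /= IHj -addn1 modnDml addn1 addnS.
Qed.

Definition ord1 (k : nat) : 'I_k.+2 := Ordinal (isT : (1 < k.+2)%N).

(** For t = 0 nothing wraps around and the omitted index is i_1, so this factor can carry a slice
    i_1 = r. *)
Lemma skip_next_ord0 (k p : nat) (i : {ffun 'I_k.+2 -> 'I_p}) (m : 'I_k.+1) :
  skip_next i ord0 m = i (lift (ord1 k) m).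
Proof.
rewrite ffunE; congr (i _); apply: ord_inj.
by rewrite val_iter_ordS modn_small //= (ltn_ord (lift (ord1 k) m)).
Qed.

Lemma skip_next_first (k p : nat) (i : {ffun 'I_k.+2 -> 'I_p}) (t : 'I_k.+2) :
  skip_next i t ord0 = i t.
Proof. by rewrite ffunE. Qed.

(* The first and last entries of [skip_next i t] are [i t] and [i (t - 1)];
   they are distinct entries because the order is at least 3. *)
Lemma skip_next_constant (k p : nat) (i : {ffun 'I_k.+3 -> 'I_p}) :
  [forall t, [forall m, forall m', skip_next i t m == skip_next i t m']] =
  [forall s, forall s', i s == i s'].
Proof.
apply/forallP/forallP => [ci|ci t]; last first.
  apply/forallP=> m; apply/forallP=> m'; rewrite !ffunE.
  by move: (ci (iter (bump 1 m) (@ordS _) t)) => /forallP.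
have next s : i (ordS s) = i s.
  have /forallP/(_ ord0)/forallP/(_ ord_max)/eqP := ci (ordS s).
  rewrite !ffunE => ->; congr (i _); apply: ord_inj.
  by rewrite val_iter_ordS /= modnDml addSn -addnS modnDr modn_small.
have fromS s : i s = i ord0.
  have -> : s = iter s (@ordS _) ord0.
    by apply: ord_inj; rewrite val_iter_ordS add0n modn_small.
  by elim: (s : nat) => // j IHj; rewrite iterS next.
by move=> s; apply/forallP=> s'; rewrite !fromS.
Qed.

Lemma prodr_natr_bool (R : comPzSemiRingType) (I : finType) (P : pred I) :
  \prod_(t : I) (P t)%:R = [forall t, P t]%:R :> R.
Proof.
have [/forallP allP|/forallPn[t nPt]] := boolP [forall t, P t].
  by rewrite big1 // => t _; rewrite allP.
by rewrite (bigD1 t) //= (negPf nPt) mul0r.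
Qed.

Lemma sum_ord_eqn (R : pzSemiRingType) (p a : nat) :
  \sum_(r < p) (a == r)%:R = (a < p)%:R :> R.
Proof.
have [lt_ap|le_pa] := ltnP a p.
  rewrite (bigD1 (Ordinal lt_ap)) //= eqxx big1 ?addr0 // => r.
  by rewrite -val_eqE /= eq_sym => /negPf->.
rewrite big1 // => r _; case: eqP => // a_eq.
by have := ltn_ord r; rewrite -a_eq ltnNge le_pa.
Qed.

(** At most one [i'] matches; summing over it avoids casting [i] down to ['I_n]. [slice] uses the
    same device. *)
Definition zero_extension (C : nmodType) (k n p : nat) (A : hypermatrix C k n) :
    hypermatrix C k p :=
  fun i => \sum_(i' : {ffun 'I_k -> 'I_n} | [forall s, i' s == i s :> nat]) A i'.

Lemma zero_extension_widen (C : nmodType) (k n p : nat) (hnp : (n <= p)%N)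
    (A : hypermatrix C k n) (i : {ffun 'I_k -> 'I_n}) :
  zero_extension A [ffun s => widen_ord hnp (i s)] = A i.
Proof.
rewrite /zero_extension (big_pred1 i) // => i'.
apply/forallP/eqP => [eqi|-> s]; last by rewrite ffunE.
by apply/ffunP=> s; apply/val_inj/eqP; have := eqi s; rewrite ffunE.
Qed.

Lemma zero_extension_out (C : nmodType) (k n p : nat) (A : hypermatrix C k n)
    (i : {ffun 'I_k -> 'I_p}) (s : 'I_k) :
  (n <= i s)%N -> zero_extension A i = 0.
Proof.
move=> le_ni; rewrite /zero_extension big_pred0 // => i'.
apply/forallP => /(_ s)/eqP eqi.
by have := ltn_ord (i' s); rewrite eqi ltnNge le_ni.
Qed.

Definition slice (C : nmodType) (k n p : nat) (A : hypermatrix C k.+2 n)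
    (r : nat) (j : {ffun 'I_k.+1 -> 'I_p}) : C :=
  \sum_(i' : {ffun 'I_k.+2 -> 'I_n} | (i' (ord1 k) == r :> nat) &&
       [forall m, i' (lift (ord1 k) m) == j m :> nat]) A i'.

Lemma slice_skip_next (C : nmodType) (k n p : nat) (A : hypermatrix C k.+2 n)
    (i : {ffun 'I_k.+2 -> 'I_p}) :
  slice A (i (ord1 k)) (skip_next i ord0) = zero_extension A i.
Proof.
apply: eq_bigl => i'; apply/andP/forallP => [[i1 /forallP im] s|eqi].
  case: (unliftP (ord1 k) s) => [m|] -> //.
  by have := im m; rewrite skip_next_ord0.
by split=> //; apply/forallP=> m; rewrite skip_next_ord0.
Qed.

(* Rows r < n carry the slices, rows n <= r < 2n their opposites, and row 2n
   carries delta. *)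
Definition slice_data (C : numClosedFieldType) (k n p : nat)
    (A : hypermatrix C k.+3 n) : spectral_data3 C k.+3 p :=
  SpectralData3
    (fun t j => \row_r
       if r == (n + n)%N :> nat then [forall m, forall m', j m == j m']%:R
       else if (n + n < r)%N then 0
       else let r' := if (r < n)%N then r : nat else (r - n)%N in
         if t == ord0 then slice A r' j
         else if t == ord1 k.+1 then
           (-1) ^+ (n <= r)%N * (j ord0 == r' :> nat)%:R
         else 1)
    (fun _ _ => \row_r (r < n)%N%:R).

(** In a slice row, factor 0 is the slice, factor 1 tests i_1 and carries the sign, and the others
    are 1. In row 2n each factor tests whether its own indices agree; jointly this is delta. *)
Lemma slice_data_prod (C : numClosedFieldType) (k n p : nat)
    (A : hypermatrix C k.+3 n) (i : {ffun 'I_k.+3 -> 'I_p}) (r : 'I_p) :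
  \prod_(t < k.+3) sd3_q (slice_data p A) t (skip_next i t) ord0 r =
  ((i (ord1 _) == r :> nat)%:R - (i (ord1 _) + n == r)%N%:R)
    * zero_extension A i
  + (n + n == r)%N%:R * [forall s, forall s', i s == i s']%:R.
Proof.
set b : nat := i (ord1 _).
(* For i_1 >= n the bracket may be nonzero in a row holding no matching slice; the formula survives
   because the extension vanishes there. *)
have out : (n <= b)%N -> zero_extension A i = 0 by exact: zero_extension_out.
under eq_bigr do rewrite mxE.
rewrite (eq_sym (r : nat)).
have [eq_r|ne_r] := eqVneq (n + n)%N r.
  rewrite prodr_natr_bool skip_next_constant mul1r.
  have [/out->|lt_bn] := leqP n b; first by rewrite mulr0 add0r.
  have -> : (b == r) = false by lia.
  have -> : (b + n == r)%N = false by lia.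
  by rewrite subrr mul0r add0r.
rewrite mul0r addr0; have [lt_r|le_r] := ltnP (n + n) r.
  rewrite (bigD1 ord0) //= mul0r.
  have [/out->|lt_bn] := leqP n b; first by rewrite mulr0.
  have -> : (b == r) = false by lia.
  have -> : (b + n == r)%N = false by lia.
  by rewrite subrr mul0r.
set r' := if _ then _ else _.
rewrite (bigD1 ord0) //= (bigD1 (ord1 _)) //= big1 => [|t /andP[t0 t1]]; last first.
  by rewrite (negPf t0) (negPf t1).
rewrite mulr1 skip_next_first -/b.
have [eq_b|ne_b] := eqVneq b r'.
  rewrite -eq_b slice_skip_next mulr1 mulrC; move: eq_b; rewrite {}/r'.
  have [lt_rn|le_nr] := ltnP r n => eq_b.
    rewrite eq_b eqxx; have -> : (r + n == r)%N = false by lia.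
    by rewrite subr0 expr0.
  have [/out->|lt_bn] := leqP n b; first by rewrite !mulr0.
  have -> : (b == r) = false by lia.
  have -> : (b + n == r)%N = true by lia.
  by rewrite sub0r expr1.
rewrite !mulr0; move: ne_b; rewrite {}/r'.
have [/out->|lt_bn] := leqP n b; first by rewrite mulr0.
have [lt_rn|le_nr] := ltnP r n => ne_b.
  have -> : (b == r) = false by lia.
  have -> : (b + n == r)%N = false by lia.
  by rewrite subrr mul0r.
have -> : (b == r) = false by lia.
have -> : (b + n == r)%N = false by lia.
by rewrite subrr mul0r.
Qed.

(** For i_1 < n, only rows i_1 and n + i_1 carry slice terms. Unweighted they cancel, leaving delta
    from row 2n; the weights keep the first alone. All these rows exist since p > 2n. *)
Lemma slice_data_decomposition (C : numClosedFieldType) (k n p : nat)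
    (A : hypermatrix C k.+3 n) : (n + n < p)%N ->
  is_spectral_decomposition3 (zero_extension A) (slice_data p A).
Proof.
move=> lt2np; split=> i; set b : nat := i (ord1 _).
  transitivity (\sum_(r < p) (b == r)%:R * zero_extension A i).
    by rewrite -mulr_suml sum_ord_eqn ltn_ord mul1r.
  apply: eq_bigr => r _; rewrite big_split /= slice_data_prod -/b.
  have [lt_rn|le_nr] := ltnP r n.
    rewrite big1 => [|t _]; last by rewrite big1 // => s _; rewrite mxE lt_rn.
    have -> : (b + n == r)%N = false by lia.
    have -> : (n + n == r)%N = false by lia.
    by rewrite mul1r subr0 mul0r addr0.
  (* The weight with t = s = 0 occurs, since 0 is not the successor of 0, and it already kills the
     row. *)
  rewrite (bigD1 ord0) //= (bigD1 ord0) //= mxE ltnNge le_nr !mul0r.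
  have [le_nb|lt_bn] := leqP n b.
    by rewrite (@zero_extension_out _ _ _ _ A i (ord1 _)) ?mulr0.
  have -> : (b == r) = false by lia.
  by rewrite mul0r.
under eq_bigr do rewrite slice_data_prod -/b.
rewrite big_split /= -!mulr_suml sumrB !sum_ord_eqn ltn_ord lt2np mul1r.
have [le_nb|lt_bn] := leqP n b.
  by rewrite (@zero_extension_out _ _ _ _ A i (ord1 _)) ?mulr0 ?add0r.
have -> : (b + n < p)%N by lia.
by rewrite subrr mul0r add0r.
Qed.

Lemma decomposable_extension_large (C : numClosedFieldType) (k n p : nat)
    (hnp : (n <= p)%N) (A : hypermatrix C k n) : (1 < k)%N -> (n + n < p)%N ->
  exists d : spectral_data C k p, decomposable_extension hnp A d.
Proof.
case: k A => [|[|[|k]]] // A _ lt2np.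
  exact: decomposable_extension2 (ltnW lt2np).
exists (slice_data p A); exists (zero_extension A); split.
  exact: slice_data_decomposition.
exact: zero_extension_widen.
Qed.

(** * Choice of the assignment *)

Theorem theorem2 (R : realType) (n k : nat) (hk : (2 <= k)%N) (hkn : (k <= n)%N) :
  exists Phi : (ksubset n k -> spectral_data R[i] k k) ->
               spectral_data R[i] k (n * 'C(n, k)),
  forall A : hypermatrix R[i] k n,
    no_degenerate_hyperedges A ->
  forall D : ksubset n k -> spectral_data R[i] k k,
    (forall S : ksubset n k, is_spectral_decomposition (induced A S) (D S)) ->
  exists B : hypermatrix R[i] k (n * 'C(n, k)),
    is_spectral_decomposition B (Phi D) /\
    forall i : {ffun 'I_k -> 'I_n},
      B [ffun s => widen_ord (leq_mul_bin hkn) (i s)] = A i.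
Proof.
pose compatible (A : hypermatrix R[i] k n) D := no_degenerate_hyperedges A /\
  forall S : ksubset n k, is_spectral_decomposition (induced A S) (D S).
have ext A D : compatible A D ->
    exists d, decomposable_extension (leq_mul_bin hkn) A d.
  case=> _ hD; have [eq_kn|ne_kn] := eqVneq k n; last first.
    apply: decomposable_extension_large => //.
    by apply: double_lt_mul_bin; rewrite // ltn_neqAle ne_kn.
  subst n; apply: (decomposable_extension_eq _ (d := D (ksubsetT k))).
    by rewrite binn muln1.
  by have /funext <- := inducedT A.
have uniq A A' D : compatible A D -> compatible A' D -> A = A'.
  move=> [ndA hA] [ndA' hA']; apply/funext/(induced_inj ndA ndA') => S.
  exact: spectral_decomposition_inj (hA S) (hA' S).
(* [Phi D] may not depend on [A]; by [uniq] at most one [A] is compatible with [D], so an extension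
   of that one serves. *)
have /boolp.choice[Phi PhiP] : forall D, exists d, forall A, compatible A D ->
    decomposable_extension (leq_mul_bin hkn) A d.
  move=> D; have [[A cA]|noA] := pselect (exists A, compatible A D).
    have [d dA] := ext A D cA.
    by exists d => A' cA'; rewrite -(uniq A A' D).
  have [d] := spectral_data_inhabited R[i] k (n * 'C(n, k)).
  by exists d => A cA; case: noA; exists A.
by exists Phi => A ndA D hD; apply: PhiP.
Qed.
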